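(* There exists a constant $c>1$ such that $|\mathcal{T}(n)| > c^{n}$ holds for all sufficiently large $n$.
   Context: Graphs are finite. For a graph $G=(V,E)$, $\tau(G)$ denotes the number of spanning trees of $G$. A graph is simple if it has no loops or multiple edges. For an integer $n\ge 3$, $$\mathcal{T}(n) := \{\tau(G) : G=(V,E) \text{ is connected, simple, and planar, and } |V|=n\},$$ a finite set of positive integers, and $|\mathcal{T}(n)|$ denotes its cardinality. *)

(* Defs.v *)
From HB Require Import structures.
From mathcomp Require Import all_boot all_order all_algebra.
From mathcomp Require Import finmap.
From mathcomp Require Import boolp classical_sets functions cardinality.
From mathcomp Require Import set_interval reals topology normedtype.

Set Implicit Arguments.
Unset Strict Implicit.
Unset Printing Implicit Defensive.

Import Order.TTheory GRing.Theory Num.Theory.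
Import numFieldNormedType.Exports.

Local Open Scope classical_set_scope.
Local Open Scope ring_scope.

Record sgraph := SGraph {
  vertex :> finType;
  adj : rel vertex;
  adj_sym : symmetric adj;
  adj_irrefl : irreflexive adj }.

Definition edges (G : sgraph) : {set {set G}} :=
  [set [set xy.1; xy.2]%SET | xy : G * G & adj xy.1 xy.2]%SET.

Definition rel_connected (V : finType) (r : rel V) : Prop :=
  forall x y : V, connect r x y.

(* A duplicate-free closed walk of length 2 runs back and forth along a single
   edge, hence the bound on the length of a cycle. *)
Definition rel_acyclic (V : finType) (r : rel V) : Prop :=
  forall c : seq V, ucycle r c -> (size c <= 2)%N.

Definition graph_connected (G : sgraph) : Prop := rel_connected (@adj G).

Definition spanning_tree (G : sgraph) (F : {set {set G}}) : Prop :=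
  let r := [rel x y : G | [set x; y]%SET \in F] in
  [/\ F \subset edges G, rel_connected r & rel_acyclic r].

Definition tau (G : sgraph) : nat :=
  #|[set F : {set {set G}} | `[< spanning_tree F >]]%SET|.

Section Planarity.
Variable R : realType.

(* Vertices are distinct points of the plane; each edge is a simple arc
   parametrized by [0, 1] in either direction between its end vertices; the
   interior of an edge contains no vertex and no point of another edge. *)
Definition plane_drawing (G : sgraph) (p : G -> R * R)
    (a : {set G} -> R -> R * R) : Prop :=
  [/\ injective p,
      forall e, e \in edges G ->
        {within `[0, 1]%classic, continuous (a e)} /\
        {in `[0, 1] &, injective (a e)},
      forall x y : G, adj x y ->
        let e := [set x; y]%SET in
        (a e 0 = p x /\ a e 1 = p y) \/ (a e 0 = p y /\ a e 1 = p x),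
      forall e, e \in edges G -> forall t : R, t \in `]0, 1[ ->
        forall x : G, a e t <> p x
    & forall e f, e \in edges G -> f \in edges G -> e <> f ->
        forall s t : R, s \in `]0, 1[ -> t \in `]0, 1[ -> a e s <> a f t].

Definition planar (G : sgraph) : Prop :=
  exists (p : G -> R * R) (a : {set G} -> R -> R * R), plane_drawing p a.

Definition tree_numbers (n : nat) : set nat :=
  [set k | exists G : sgraph,
     [/\ graph_connected G, planar G, #|G| = n & tau G = k]]%classic.

(* [fset_set] returns the empty set on infinite sets, so the cardinality
   [#|` fset_set (tree_numbers n)|] is meaningful thanks to this fact. *)
Lemma finite_tree_numbers (n : nat) : finite_set (tree_numbers n).
Proof.
apply: (@sub_finite_set _ _ `I_((2 ^ (2 ^ n)).+1)); last exact: finite_II.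
move=> _ [G [_ _ <- <-]] /=; rewrite ltnS.
apply: leq_trans (max_card _) _.
have card_set (T : finType) : #|{: {set T}}| = (2 ^ #|T|)%N.
  by rewrite -(cardsT T) -card_powerset powersetT cardsT.
by rewrite !card_set.
Qed.

End Planarity.

(* Main.v *)
Require Import Defs.
From HB Require Import structures.
From mathcomp Require Import all_boot all_order all_algebra.
From mathcomp Require Import finmap.
From mathcomp Require Import boolp classical_sets functions cardinality.
From mathcomp Require Import set_interval reals topology normedtype.
From mathcomp Require Import zify lra.

(** The graphs that produce many tree numbers are fans: a path 0 - 1 - ... - k
    together with some of the spokes from 0 to a later vertex. They are planar
    (put the hub 0 at the origin and the vertex i at (1, i)).

    For a fan let t be its number of spanning trees and s its number of
    spanning forests with two components that separate 0 from k. Prolonging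
    the path by one vertex turns (t, s) into (t, t + s), and into
    (2t + s, t + s) if the new vertex gets a spoke. Hence a block of a - 1
    vertices without spoke followed by one vertex with a spoke acts by
    (t, s) |-> ((a + 1) t + s, a t + s), which is a continued fraction step:
    as long as 0 < s <= t, the new pair determines t (as a difference), then
    a and s (as a division with remainder). So the words of length m in the
    block lengths 1, ..., 6 lead from (1, 1) to 6 ^ m different pairs.

    Different pairs may share the same t, but since 0 < s <= t at most t of
    them do. Therefore the number of different values of t is at least the sum
    of 1 / t over the pairs ([sum_inv_le_undup]). A block of length a multiplies
    t by at most a + 2, so that sum is at least the m-th power of
    1/3 + 1/4 + ... + 1/8 > 6/5 ([sum_inv_pairs]): the harmonic series makes
    this constant exceed 1, and that is all the growth needed. A fan with m
    blocks has at most 6 m + 2 vertices, and prolonging the path without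
    spokes leaves t unchanged, which reaches every larger number of vertices.

    What remains is the recurrence for t and s ([tau_fan]). Cut the path at the
    edges that a set F of edges omits. Then F is a spanning tree exactly when
    each of the resulting segments contains exactly one anchor, an anchor being
    the hub or the end of a spoke in F. A two-state automaton that reads the
    vertices in order and remembers whether the current segment has its anchor
    decides this condition, and t and s count the choices of F that lead
    to its two states. *)

Set Implicit Arguments.
Unset Strict Implicit.
Unset Printing Implicit Defensive.

Import Order.TTheory GRing.Theory Num.Theory.

Local Open Scope nat_scope.

(** * Subgraphs of a fan and their segments *)

Lemma last_iota_succ i n : last i (iota i.+1 n) = i + n.
Proof. by elim: n i => [|n IH] i; rewrite ?addn0 //= IH addnS. Qed.

Section SubFan.
Variables b c : nat -> bool.

(** [b j] selects the path edge from [j.-1] to [j], and [c j] the spoke to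
    [j]. Everything is indexed by natural numbers so that inductions on the
    number of vertices never change the type of the vertices. *)
Definition subfan k : rel 'I_k.+1 := fun x y =>
  [|| (y == x.+1 :> nat) && b y, (x == y.+1 :> nat) && b x,
      (x == 0 :> nat) && c y | (y == 0 :> nat) && c x].

(** Segments are the maximal runs of selected path edges; they are numbered
    from the hub on. *)
Fixpoint seg i := if i is i'.+1 then seg i' + ~~ b i else 0.

(** The vertices from which the hub is reached without passing through another
    segment. *)
Definition anchor i := (i == 0) || c i.

Definition one_anchor k :=
  (forall i, i <= k -> exists j, [/\ j <= k, anchor j & seg j = seg i]) /\
  (forall i j, i <= k -> j <= k -> anchor i -> anchor j ->
     seg i = seg j -> i = j).

(** [None] is the failure state: some segment was closed without an anchor or
    received a second one. [Some q] says whether the current segment has its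
    anchor. *)
Definition scan_step (o : option bool) (x : bool * bool) : option bool :=
  if o is Some q then
    if x.1 then if q && x.2 then None else Some (q || x.2)
    else if q then Some x.2 else None
  else None.

(** The initial state is [Some true] because the hub anchors the segment that
    it starts. *)
Fixpoint scan k :=
  if k is k'.+1 then scan_step (scan k') (b k, c k) else Some true.

Lemma leq_seg i j : i <= j -> seg i <= seg j.
Proof.
elim: j => [|j IH]; first by rewrite leqn0 => /eqP ->.
rewrite leq_eqVlt => /predU1P [-> //|/IH]; rewrite /=; lia.
Qed.

Lemma seg_eq_b i j t : i < t <= j -> seg i = seg j -> b t.
Proof.
move=> /andP[it tj] e; have := leq_seg tj.
case: t it tj => // t it tj /=.
by have := @leq_seg i t it; case: (b t.+1) => //=; lia.
Qed.

(** The part of [one_anchor k] that no later vertex can repair: the last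
    segment may still lack its anchor. *)
Definition safe k :=
  (forall i j, i <= k -> j <= k -> anchor i -> anchor j ->
     seg i = seg j -> i = j) /\
  (forall i, i <= k -> seg i < seg k ->
     exists j, [/\ j <= k, anchor j & seg j = seg i]).

Definition anchored k := exists j, [/\ j <= k, anchor j & seg j = seg k].

Lemma seg_joined k : b k.+1 -> seg k.+1 = seg k.
Proof. by move=> /= ->; rewrite addn0. Qed.

Lemma seg_cut k : ~~ b k.+1 -> seg k.+1 = (seg k).+1.
Proof. by move=> /= ->; rewrite addn1. Qed.

Lemma anchored_joined k : b k.+1 -> anchored k.+1 <-> anchored k \/ c k.+1.
Proof.
move=> bk; rewrite /anchored (seg_joined bk); split.
  move=> [j []]; rewrite leq_eqVlt => /predU1P[->|jk aj ej]; first by right.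
  by left; exists j.
move=> [[j [jk aj ej]]|ck]; first by exists j; split=> //; apply: leqW.
by exists k.+1; rewrite (seg_joined bk).
Qed.

Lemma anchored_cut k : ~~ b k.+1 -> anchored k.+1 <-> c k.+1.
Proof.
move=> bk; split; last by move=> ck; exists k.+1.
move=> [j []]; rewrite leq_eqVlt => /predU1P[->//|jk _].
by move=> e; have := @leq_seg j k jk; rewrite e (seg_cut bk) ltnn.
Qed.

Lemma safe_joined k :
  b k.+1 -> safe k.+1 <-> safe k /\ ~ (c k.+1 /\ anchored k).
Proof.
move=> bk; have segS := seg_joined bk; split.
  move=> [U L]; split; [split|].
  - by move=> i j ik jk; apply: U; apply: leqW.
  - move=> i ik; rewrite -segS => lt; have [||j [jk aj ej]] := L i => //.
      exact: leqW.
    exists j; split=> //; move: jk; rewrite leq_eqVlt => /predU1P[ejk|//].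
    by move: lt; rewrite -ej ejk ltnn.
  - move=> [ck [j [jk aj ej]]].
    have := U j k.+1 (leqW jk) (leqnn _) aj.
    by rewrite segS => /(_ ck ej) ejk; move: jk; rewrite ejk ltnn.
move=> [[U L] N]; split.
  have N' j : j <= k -> c k.+1 -> anchor j -> seg j <> seg k.
    by move=> jk ck aj ej; apply: N; split=> //; exists j.
  move=> i j; rewrite leq_eqVlt => /predU1P[->|ik];
    rewrite leq_eqVlt => /predU1P[->|jk] //; rewrite ?segS.
  + by move=> ck aj e; case: (N' j).
  + by move=> ai ck e; case: (N' i).
  + exact: U.
move=> i; rewrite segS leq_eqVlt => /predU1P[->|ik lt].
  by rewrite segS ltnn.
by have [j [jk aj ej]] := L i ik lt; exists j; split=> //; apply: leqW.
Qed.

Lemma safe_cut k : ~~ b k.+1 -> safe k.+1 <-> safe k /\ anchored k.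
Proof.
move=> bk; have segS := seg_cut bk.
have down i : i <= k -> (exists j, [/\ j <= k.+1, anchor j & seg j = seg i]) <->
    (exists j, [/\ j <= k, anchor j & seg j = seg i]).
  move=> ik; split=> -[j [jk aj ej]]; exists j; split=> //; last exact: leqW.
  move: jk; rewrite leq_eqVlt => /predU1P[ejk|//].
  by have := leq_seg ik; rewrite -ej ejk segS ltnn.
split.
  move=> [U L]; split; [split|].
  - by move=> i j ik jk; apply: U; apply: leqW.
  - move=> i ik lt; apply/down => //; apply: L; first exact: leqW.
    by rewrite segS ltnW.
  - by apply/down => //; apply: L; rewrite ?segS.
move=> [[U L] A]; split.
  move=> i j; rewrite leq_eqVlt => /predU1P[->|ik];
    rewrite leq_eqVlt => /predU1P[->|jk] //; rewrite ?segS.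
  + by move=> _ _ e; have := @leq_seg j k jk; rewrite -e ltnn.
  + by move=> _ _ e; have := @leq_seg i k ik; rewrite e ltnn.
  + exact: U.
move=> i; rewrite segS leq_eqVlt => /predU1P[->|ik lt].
  by rewrite segS ltnn.
apply/down => //; have := @leq_seg i k ik.
rewrite leq_eqVlt => /predU1P[->//|]; exact: L.
Qed.

(** The automaton maintains the invariant that makes it correct: its failure
    means that [safe] is lost, and otherwise its state is the truth value of
    [anchored]. *)
Lemma scanP k : if scan k is Some q then safe k /\ (q <-> anchored k)
  else ~ safe k.
Proof.
elim: k => [|k IH].
  split; last by split=> // _; exists 0.
  by split=> [i j|i]; rewrite !leqn0 => /eqP -> // /eqP ->.
rewrite /=; case: (scan k) IH => [q|] /=; last first.
  by move=> nS; case: (boolP (b k.+1)) => bk;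
    [move/(safe_joined bk) => -[] | move/(safe_cut bk) => -[]].
move=> [sk qk]; case: (boolP (b k.+1)) => [bk|bk].
  case: (boolP (q && c k.+1)) => [/andP[/qk aq ck]|nqc].
    by move/(safe_joined bk) => -[_ []].
  split.
    apply/(safe_joined bk); split=> // -[ck /qk q1].
    by rewrite q1 ck in nqc.
  by rewrite (anchored_joined bk) -qk; split=> /orP.
case: (boolP q) => [q1|q0].
  split; last by rewrite (anchored_cut bk).
  by apply/(safe_cut bk); split=> //; apply/qk.
by move/(safe_cut bk) => [_ /qk]; apply/negP.
Qed.

Lemma scan_one_anchor k : scan k = Some true <-> one_anchor k.
Proof.
have H := scanP k; split.
  move=> e; rewrite e in H; move: H => [[U L] [/(_ isT) A _]]; split=> // i ik.
  have := leq_seg ik; rewrite leq_eqVlt => /predU1P[->//|]; exact: L.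
move=> [E U].
have S : safe k by split=> // i ik _; apply: E.
case: (scan k) H => [q [_ qk]|//].
by congr Some; apply/qk; apply: E.
Qed.

(** The edge from 0 to 1 is a path edge; counting it as a spoke too would
    represent it twice and break the correspondence between anchors and
    cycles. *)
Hypothesis c1 : c 1 = false.

Lemma subfan_sym k : symmetric (@subfan k).
Proof.
by move=> x y; rewrite /subfan orbCA; congr [|| _, _ | _]; apply: orbC.
Qed.

Lemma subfan_inordS k i : i < k -> b i.+1 ->
  subfan (inord i : 'I_k.+1) (inord i.+1).
Proof. by move=> ik bi; rewrite /subfan !inordK ?eqxx ?bi //; apply: leqW. Qed.

Lemma connect_inord k i j : i <= j <= k -> seg i = seg j ->
  connect (@subfan k) (inord i) (inord j).
Proof.
elim: j => [|j IH]; first by rewrite leqn0 => /andP[/eqP->].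
move=> /andP[ij jk] e; move: ij; rewrite leq_eqVlt => /predU1P[->//|ij].
have bj : b j.+1 by apply: (seg_eq_b _ e); rewrite ij leqnn.
apply: connect_trans (connect1 (subfan_inordS jk bj)).
by apply: IH; rewrite ?e ?seg_joined // -ltnS ij ltnW.
Qed.

Lemma connect_seg k (x y : 'I_k.+1) : seg x = seg y -> connect (@subfan k) x y.
Proof.
have csym := sym_connect_sym (@subfan_sym k).
wlog xy : x y / x <= y => [H e|].
  by case/orP: (leq_total x y) => [/H->//|/H]; rewrite csym; apply.
move=> e; rewrite -(inord_val x) -(inord_val y).
by apply: connect_inord; rewrite // xy -ltnS ltn_ord.
Qed.

Lemma subfan_connected k :
  (forall i, i <= k -> exists j, [/\ j <= k, anchor j & seg j = seg i]) ->
  rel_connected (@subfan k).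
Proof.
move=> A; have csym := sym_connect_sym (@subfan_sym k).
suff H (x : 'I_k.+1) : connect (@subfan k) x ord0.
  by move=> x y; apply: connect_trans (H x) _; rewrite csym.
have [j [jk aj e]] := A x (ltn_ord x).
apply: (@connect_trans _ _ (inord j)).
  by apply: connect_seg; rewrite inordK.
move: aj => /predU1P[->|cj].
  by rewrite (_ : inord 0 = ord0) //; apply/val_inj; rewrite /= inordK.
by apply: connect1; rewrite /subfan inordK // cj !orbT.
Qed.

(** The set of vertices of a segment without anchor is closed under adjacency
    and misses the hub. *)
Lemma connected_anchor k : rel_connected (@subfan k) ->
  forall i, i <= k -> exists j, [/\ j <= k, anchor j & seg j = seg i].
Proof.
move=> C i ik.
have [/existsP[j /andP[aj /eqP e]]|/existsPn N] :=
  boolP [exists j : 'I_k.+1, anchor j && (seg j == seg i)].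
  by exists j; rewrite -ltnS.
have cl : fingraph.closed (@subfan k) [pred x : 'I_k.+1 | seg x == seg i].
  have N' (x y : 'I_k.+1) : x = 0 :> nat -> c y ->
      (seg x == seg i) = (seg y == seg i).
    move=> x0 cy; have := N x; have := N y.
    by rewrite /anchor x0 cy eqxx orbT /= => /negPf -> /negPf ->.
  move=> x y /or4P[] /andP[/eqP e]; rewrite !inE.
  - by rewrite e => /seg_joined ->.
  - by rewrite e => /seg_joined ->.
  - exact: N'.
  - by move=> cx; rewrite (N' y x).
have := closed_connect cl (C (inord i) ord0); rewrite !inE inordK // eqxx.
by have := N ord0; rewrite /anchor /= => /negPf ->.
Qed.

Lemma path_iota k i n : i + n <= k -> seg i = seg (i + n) ->
  path (@subfan k) (inord i) [seq inord j | j <- iota i.+1 n].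
Proof.
elim: n i => [//|n IH] i ink e.
have ink' : i.+1 + n <= k by rewrite addSnnS.
have e' : seg i.+1 = seg (i.+1 + n).
  apply/eqP; rewrite eqn_leq leq_seg ?leq_addr // addSnnS -e.
  exact: leq_seg.
rewrite [iota _ _]/= map_cons [path _ _ _]/= IH // andbT.
have bi : b i.+1 by apply: (seg_eq_b _ e); rewrite ltnSn addnS ltnS leq_addr.
by apply: subfan_inordS => //; apply: leq_trans ink'; apply: leq_addr.
Qed.

(** Two anchors in one segment close a cycle: the part of the path between
    them together with the hub. *)
Lemma acyclic_anchor k : rel_acyclic (@subfan k) ->
  forall i j, i <= k -> j <= k -> anchor i -> anchor j ->
     seg i = seg j -> i = j.
Proof.
move=> AC; suff H i j :
    i < j -> j <= k -> anchor i -> anchor j -> seg i <> seg j.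
  move=> i j ik jk ai aj e; case: (ltngtP i j) => // ij.
    by case: (H i j).
  by case: (H j i).
move=> ij jk ai; case: j ij jk => [//|j] ij jk cj e.
have j0 : 0 < j by case: (j) cj => //; rewrite /anchor c1.
(* If the first anchor is the hub, the cycle enters the segment at 1. *)
pose i' := maxn 1 i.
have i0 : 0 < i' by rewrite leq_max.
have ii : i <= i' by rewrite leq_max leqnn orbT.
have ij' : i' <= j by rewrite geq_max j0 -ltnS.
have e' : seg i' = seg j.+1.
  by apply/eqP; rewrite eqn_leq leq_seg ?leqW //= -[X in X <= _]e leq_seg.
have h0 : subfan (ord0 : 'I_k.+1) (inord i').
  rewrite /subfan inordK; last by rewrite ltnS (leq_trans ij') // ltnW.
  move: ai; rewrite /i'; case: (i) ij e => [|[|n]].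
  - move=> _ e _; rewrite (maxn_idPl _) // eqxx.
    by rewrite (seg_eq_b _ e).
  - by rewrite /anchor c1.
  - move=> _ _ cn; rewrite (maxn_idPr _) //; move: cn.
    by rewrite /anchor /= => ->.
suff /AC : ucycle (@subfan k)
    (ord0 :: [seq inord t | t <- iota i' (j.+1 - i').+1]).
  by rewrite /= size_map size_iota; lia.
rewrite /ucycle; apply/andP; split.
  rewrite /cycle rcons_path; apply/andP; split.
    rewrite [path _ _ _]/= h0 /=.
    by rewrite path_iota // subnKC // ltnW.
  rewrite [last _ _]/= last_map (_ : last _ _ = j.+1); last first.
    by rewrite last_iota_succ subnKC // ltnW.
  by apply/or4P/Or44; rewrite inordK.
rewrite cons_uniq; apply/andP; split.
  apply/negP => /mapP[t]; rewrite mem_iota.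
  by move=> ti /(congr1 val) /=; rewrite inordK; lia.
rewrite map_inj_in_uniq ?iota_uniq // => t u; rewrite !mem_iota => ti ui.
by move/(congr1 val); rewrite /= !inordK //; lia.
Qed.

Lemma path_seg k (x : 'I_k.+1) s : path (@subfan k) x s ->
  ord0 \notin x :: s -> seg (last x s) = seg x.
Proof.
elim: s x => [//|y s IH] x /= /andP[xy ps].
rewrite inE negb_or => /andP[x0 ys]; rewrite IH //.
move: ys; rewrite inE negb_or => /andP[y0 _].
move: x0 y0; rewrite -!val_eqE /= => x0 y0.
case/or4P: xy => /andP[/eqP e]; last 2 first.
- by rewrite e in x0.
- by rewrite e in y0.
- by rewrite e => /seg_joined.
- by rewrite e => /seg_joined.
Qed.

Lemma subfan_hub k (z x : 'I_k.+1) : z = 0 :> nat -> x != 0 :> nat ->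
  subfan z x -> x = 1 :> nat /\ seg x = 0 \/ c x.
Proof.
move=> z0 x0 /or4P[] /andP[]; last 2 first.
- by right.
- by move=> xx; rewrite xx in x0.
- by rewrite z0 => /eqP -> /= ->; left.
- by rewrite z0.
Qed.

Lemma subfan_below k (z x : 'I_k.+1) : z != 0 :> nat -> x != 0 :> nat ->
  x <= z -> subfan z x -> z = x.+1 :> nat.
Proof.
move=> z0 x0 xz /or4P[] /andP[/eqP e]; move: z0 x0 xz; rewrite e //.
by rewrite ltnn.
Qed.

(** Rotate a cycle so that it starts at [z], which is the hub if the cycle
    visits it and the largest vertex otherwise, and let [x] and [w] be the two
    neighbours of [z] on the cycle. If [z] is the largest vertex, both equal
    [z - 1]. If [z] is the hub, the rest of the cycle runs inside one segment,
    where [x] and [w] give two different anchors: themselves, except that the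
    hub replaces the vertex 1 when it is reached along the path. *)
Lemma anchor_acyclic k :
  (forall i j, i <= k -> j <= k -> anchor i -> anchor j ->
     seg i = seg j -> i = j) -> rel_acyclic (@subfan k).
Proof.
move=> U p cyc; rewrite leqNgt; apply/negP => sp.
have [z zp zmax] : exists2 z : 'I_k.+1, z \in p &
    z = ord0 \/ ord0 \notin p /\ forall x, x \in p -> x <= z.
  have [p0|p0] := boolP (ord0 \in p); first by exists ord0 => //; left.
  case: p sp p0 {cyc} => [//|z0 p] _ p0.
  pose P := [pred x | x \in z0 :: p].
  have P0 : P z0 by rewrite inE mem_head.
  case: (@arg_maxnP _ z0 P (fun x => x : nat) P0) => z zp mz.
  by exists z => //; right; split=> // x xp; apply: mz.
case: (rot_to zp) => i s es.
have size_s : 1 < size s by rewrite -(size_rot i p) es in sp.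
move: cyc; rewrite -(rot_ucycle i _ p) es.
have mp x : x \in z :: s -> x \in p by rewrite -es mem_rot.
case: s es size_s mp => [|x [|y s]] es //= _ mp.
rewrite /ucycle [cycle _ _]/= rcons_path => /andP[/and4P[zx xy ps]].
rewrite [last _ _]/=; set w := last y s => wz un.
have ws : w \in y :: s by apply: mem_last.
have xw : x != w.
  apply/eqP => e; rewrite -e in ws.
  by case/andP: un => _ /andP[]; rewrite ws.
have wr : w \in [:: z, x, y & s] by rewrite !inE -in_cons ws !orbT.
rewrite subfan_sym in wz.
case: zmax => [z0|[p0 zmax]]; last first.
  have nz t : t \in p -> t != 0 :> nat.
    move=> tp; apply: contraNneq p0 => t0.
    by rewrite (_ : ord0 = t) //; apply: val_inj.
  have xp : x \in p by apply: mp; rewrite !inE eqxx orbT.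
  have wp := mp _ wr.
  have := subfan_below (nz _ zp) (nz _ xp) (zmax _ xp) zx.
  rewrite (subfan_below (nz _ zp) (nz _ wp) (zmax _ wp) wz) => -[e].
  by case/eqP: xw; apply: val_inj.
have zs : ord0 \notin [:: x, y & s] by move: un; rewrite z0 /= => /andP[].
have nz t : t \in [:: x, y & s] -> t != 0 :> nat.
  move=> ts; apply: contraNneq zs => t0.
  by rewrite (_ : ord0 = t) //; apply: val_inj.
have x0 : x != 0 :> nat by apply: nz; rewrite mem_head.
have w0 : w != 0 :> nat by apply: nz; rewrite inE ws orbT.
have sxw : seg w = seg x by apply: (@path_seg _ x (y :: s)) => //=; rewrite xy.
have anc (t : 'I_k.+1) : c t -> anchor t by move=> ct; rewrite /anchor ct orbT.
have lek (t : 'I_k.+1) : t <= k by rewrite -ltnS.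
have z0' : z = 0 :> nat by rewrite z0.
case: (subfan_hub z0' x0 zx) => [[x1 sx]|cx];
  case: (subfan_hub z0' w0 wz) => [[w1 sw]|cw].
- by case/eqP: xw; apply: val_inj; rewrite /= x1.
- by move: w0; rewrite (U w 0) ?anc ?lek // sxw.
- by move: x0; rewrite (U x 0) ?anc ?lek // -sxw.
- by case/eqP: xw; apply: val_inj; rewrite /= (U x w) ?anc ?lek.
Qed.

Lemma subfan_tree k : rel_connected (@subfan k) /\ rel_acyclic (@subfan k) <->
  scan k = Some true.
Proof.
rewrite scan_one_anchor; split=> -[]; last first.
  by move=> /subfan_connected ? /anchor_acyclic.
by move=> /connected_anchor ? /acyclic_anchor.
Qed.

End SubFan.

(** * Counting the spanning trees of a fan *)

Lemma eq_set2 (T : finType) (x y x' y' : T) :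
  [set x; y]%SET = [set x'; y']%SET ->
  x = x' /\ y = y' \/ x = y' /\ y = x'.
Proof.
move=> /setP e; have := e x; have := e y; have := e x'; have := e y'.
rewrite !inE !eqxx !orbT => /pred2P hy' /pred2P hx'.
move=> /esym/pred2P hy /esym/pred2P hx.
by case: hx => ?; case: hy => ?; case: hx' => ?; case: hy' => ?; subst; auto.
Qed.

Lemma mem_edge_set (T : finType) (e : rel T) x y : symmetric e ->
  ([set x; y]%SET \in [set [set xy.1; xy.2] | xy : T * T & e xy.1 xy.2]%SET)
  = e x y.
Proof.
move=> es; apply/imsetP/idP => [[[x' y']]|exy]; last first.
  by exists (x, y); rewrite ?inE.
by rewrite inE /= => e' /eq_set2 [[-> ->]|[-> ->]] //; rewrite es.
Qed.

(** The head of a code describes the last vertex, so that prolonging the path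
    is a [cons]. *)
Fixpoint code (b c : nat -> bool) k : seq (bool * bool) :=
  if k is k'.+1 then (b k, c k) :: code b c k' else [::].

Definition run (w : seq (bool * bool)) : option bool :=
  foldr (fun x o => scan_step o x) (Some true) w.

Lemma scan_run b c k : scan b c k = run (code b c k).
Proof. by elim: k => //= k ->. Qed.

Lemma eq_code b c b' c' k : code b c k = code b' c' k <->
  (forall j, 0 < j <= k -> b j = b' j /\ c j = c' j).
Proof.
elim: k => [|k IH] /=; first by split=> // _ j; case: j.
split=> [[eb ec /IH e] j|e]; last first.
  have [-> ->] := e k.+1 (leqnn _); congr cons; apply/IH => j /andP[j0 jk].
  by apply: e; rewrite j0 leqW.
rewrite [j <= _]leq_eqVlt => /andP[j0 /predU1P[->//|jk]]; apply: e.
by rewrite j0.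
Qed.

(** Only the values on the vertices of the fan matter, which lets a relation
    be recovered from its code. *)
Lemma eq_subfan b c b' c' k (x y : 'I_k.+1) : c 0 = c' 0 ->
  (forall j, 0 < j <= k -> b j = b' j /\ c j = c' j) ->
  subfan b c x y = subfan b' c' x y.
Proof.
move=> e0 e; have ec (z : 'I_k.+1) : c z = c' z.
  have := ltn_ord z; case: (nat_of_ord z) => [//|j] jk.
  by have [] := e j.+1 jk.
have eb (z t : 'I_k.+1) :
    (t == z.+1 :> nat) && b t = (t == z.+1 :> nat) && b' t.
  case: eqP => //= tz; have tk : t <= k by rewrite -ltnS.
  by have [|-> _] := e t; rewrite // tk tz.
by rewrite /subfan !ec !eb.
Qed.

Section Fan.
Variable l : bitseq.

(** The list [l] says which vertices from 2 on have a spoke; the two leading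
    values keep 0 and 1 without spoke, and so does the default value for all
    vertices past the end of [l]. *)
Definition spoke j := nth false [:: false, false & l] j.

Definition fan_adj k : rel 'I_k.+1 := @subfan xpredT spoke k.

Lemma fan_adj_irrefl k : irreflexive (@fan_adj k).
Proof.
move=> x; rewrite /fan_adj /subfan; case: (nat_of_ord x) => [//|n].
by rewrite ltn_eqF.
Qed.

Definition fan k : sgraph :=
  SGraph (@subfan_sym xpredT spoke k) (@fan_adj_irrefl k).

(** All codes of sets of edges of the fan, spanning trees or not. *)
Fixpoint words k : seq (seq (bool * bool)) :=
  if k is k'.+1 then
    [seq (false, false) :: w | w <- words k'] ++
    [seq (true, false) :: w | w <- words k'] ++
    (if spoke k then [seq (false, true) :: w | w <- words k'] ++
                     [seq (true, true) :: w | w <- words k'] else [::])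
  else [:: [::]].

Lemma mem_cons_words k x w : (x :: w \in words k.+1) =
  (x.2 ==> spoke k.+1) && (w \in words k).
Proof.
have mc y :
    (x :: w \in [seq y :: v | v <- words k]) = (x == y) && (w \in words k).
  by apply/mapP/andP => [[v vw [-> ->]]|[/eqP -> wk]]; [rewrite eqxx|exists w].
rewrite /= !mem_cat !mc; case: (spoke _); rewrite ?mem_cat ?mc ?in_nil;
  by case: x {mc} => -[] [] /=; rewrite ?orbF ?orbT.
Qed.

Lemma uniq_words k : uniq (words k).
Proof.
have mu y s : uniq s -> uniq [seq y :: v | v : seq (bool * bool) <- s].
  by rewrite map_inj_uniq // => u v [].
have dj (x y : bool * bool) s t : x != y ->
    has (mem [seq x :: v | v <- s]) [seq y :: v | v <- t] = false.
  move=> xy; apply/hasP => -[u /mapP[v _ ->] /mapP[w _ [e]]].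
  by rewrite e eqxx in xy.
elim: k => [//|k IH] /=; rewrite !cat_uniq !has_cat !mu //.
by case: (spoke _); rewrite ?cat_uniq ?has_cat ?mu // !dj.
Qed.

Lemma code_words (b c : nat -> bool) k :
  (forall j, c j -> spoke j) -> code b c k \in words k.
Proof.
move=> cs; elim: k => [|k IH]; first by rewrite inE.
by rewrite mem_cons_words IH andbT; apply/implyP/cs.
Qed.

Lemma words_code k w : w \in words k ->
  exists b c : nat -> bool, (forall j, c j -> spoke j) /\ code b c k = w.
Proof.
elim: k w => [|k IH] w.
  rewrite inE => /eqP ->; exists xpredT, (fun=> false); by [].
case: w => [|x w].
  have nm x : ([::] \in [seq x :: v | v <- words k]) = false.
    by apply/mapP => -[].
  by rewrite /= !mem_cat !nm; case: (spoke _); rewrite ?mem_cat ?nm.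
rewrite mem_cons_words => /andP[sx /IH [b [c [cs e]]]].
exists (fun j => if j == k.+1 then x.1 else b j),
  (fun j => if j == k.+1 then x.2 else c j); split.
  by move=> j; case: eqP => [->|_]; [apply/implyP|apply: cs].
rewrite /= eqxx -surjective_pairing -e; congr cons.
by apply/eq_code => j /andP[_ jk]; rewrite ltn_eqF.
Qed.

Section EdgeSet.
Variables (k : nat) (F : {set {set fan k}}).

Definition pathbit j := [set inord j.-1; inord j : 'I_k.+1]%SET \in F.
Definition spokebit j := spoke j && ([set ord0; inord j : 'I_k.+1]%SET \in F).

(** A set of edges is determined by its code. *)
Lemma edge_setE (x y : 'I_k.+1) : F \subset edges (fan k) ->
  ([set x; y]%SET \in F) = subfan pathbit spokebit x y.
Proof.
move=> Fe.
have pb (u v : 'I_k.+1) : v = u.+1 :> nat -> pathbit v = ([set u; v]%SET \in F).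
  by move=> vu; rewrite /pathbit vu /= -vu !inord_val.
have sb (u v : 'I_k.+1) : u = 0 :> nat ->
    spokebit v = spoke v && ([set u; v]%SET \in F).
  by move=> u0; rewrite /spokebit inord_val (_ : u = ord0) //; apply: val_inj.
apply/idP/idP => [xy|].
  have := fintype.subsetP Fe _ xy.
  rewrite (@mem_edge_set _ (@fan_adj k)); last exact: subfan_sym.
  move=> /or4P[] /andP[/eqP e h]; apply/or4P.
  - by apply: Or41; rewrite e eqxx /= -e (pb x).
  - by apply: Or42; rewrite e eqxx /= -e (pb y) // finset.setUC.
  - by apply: Or43; rewrite e eqxx /= (sb x) // h.
  - by apply: Or44; rewrite e eqxx /= (sb y) // h finset.setUC.
move=> /or4P[] /andP[/eqP e].
- by rewrite (pb x).
- by rewrite (pb y) // finset.setUC.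
- by rewrite (sb x) // => /andP[].
- by rewrite (sb y) // finset.setUC => /andP[].
Qed.

Lemma spanning_tree_run : F \subset edges (fan k) ->
  spanning_tree F <-> run (code pathbit spokebit k) = Some true.
Proof.
move=> Fe; rewrite -scan_run -subfan_tree //.
have e : [rel x y : fan k | [set x; y]%SET \in F] =2 @subfan pathbit spokebit k.
  by move=> x y; apply: edge_setE.
rewrite /spanning_tree /rel_connected /rel_acyclic; split.
  move=> [_ C A]; split; first by move=> x y; rewrite -(eq_connect e).
  by move=> p; rewrite /ucycle -(eq_cycle e); apply: A.
move=> [C A]; split=> //; first by move=> x y; rewrite (eq_connect e).
by move=> p; rewrite /ucycle (eq_cycle e); apply: A.
Qed.

End EdgeSet.

(** Conversely, each admissible code comes from a set of edges. *)
Lemma code_edge_set k (b c : nat -> bool)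
    (F := [set [set xy.1; xy.2] | xy : 'I_k.+1 * 'I_k.+1 &
           subfan b c xy.1 xy.2]%SET : {set {set fan k}}) :
  (forall j, c j -> spoke j) ->
  F \subset edges (fan k) /\ code (pathbit F) (spokebit F) k = code b c k.
Proof.
move=> cs; split.
  apply/fintype.subsetP => e /imsetP[[x y]]; rewrite inE /= => xy ->.
  rewrite (@mem_edge_set _ (@fan_adj k)); last exact: subfan_sym.
  case/or4P: xy => /andP[/eqP e1 h]; apply/or4P.
  - by apply: Or41; rewrite e1 eqxx.
  - by apply: Or42; rewrite e1 eqxx.
  - by apply: Or43; rewrite e1 cs.
  - by apply: Or44; rewrite e1 cs.
apply/eq_code => j /andP[j0 jk].
rewrite /pathbit /spokebit /F !mem_edge_set; try exact: subfan_sym.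
rewrite /subfan !inordK //; last by rewrite prednK // ltnW.
have -> : j == j.-1.+1 by rewrite prednK.
have -> : (j.-1 == j.+1) = false by lia.
have -> : (j == 0) = false by lia.
split.
  case: (boolP (b j)) => [//|_] /=; rewrite orbF; apply/negP => /andP[/eqP j1].
  by have -> : j = 1 by [lia]; move=> /cs.
rewrite /= !orbF; case: (boolP (c j)) => [/[dup] /cs -> _|_].
  by rewrite orbT.
by rewrite orbF; apply/negP => /and3P[sj /eqP j1]; rewrite j1 in sj.
Qed.

(** By [edge_setE] and [code_edge_set], [code] is a bijection from the sets of
    edges to [words k], and the spanning trees correspond to the accepted
    words. *)
Lemma tau_run k :
  tau (fan k) = count (fun w => run w == Some true) (words k).
Proof.
pose A := [set F : {set {set fan k}} | `[< spanning_tree F >]]%SET.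
pose f (F : {set {set fan k}}) := code (pathbit F) (spokebit F) k.
have Asub F : F \in A -> F \subset edges (fan k).
  by rewrite inE => /asboolP[].
have finj : {in A &, injective f}.
  move=> F F' /Asub FA /Asub FA' /eq_code e; apply/setP => E.
  have E2 (H : {set {set fan k}}) : H \subset edges (fan k) -> E \in H ->
      exists x y, E = [set x; y]%SET.
    by move=> HA /(fintype.subsetP HA) /imsetP[[x y] _ ->]; exists x, y.
  have e' (x y : 'I_k.+1) : ([set x; y]%SET \in F) = ([set x; y]%SET \in F').
    by rewrite !edge_setE //; apply: eq_subfan.
  apply/idP/idP => h; [have [x [y Exy]] := E2 _ FA h
                      |have [x [y Exy]] := E2 _ FA' h]; rewrite Exy in h *.
    by rewrite -e'.
  by rewrite e'.
rewrite -size_filter -[tau _]/(#|A|) cardE -(size_map f).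
apply/perm_size/uniq_perm.
- rewrite map_inj_in_uniq ?enum_uniq // => F F'.
  by rewrite !mem_enum; apply: finj.
- by apply: filter_uniq; apply: uniq_words.
move=> w; apply/mapP/idP => [[F]|].
  rewrite mem_enum => FA ->; rewrite mem_filter code_words ?andbT; last first.
    by move=> j /andP[].
  apply/eqP/(spanning_tree_run (Asub _ FA)); move: FA.
  by rewrite inE => /asboolP.
rewrite mem_filter => /andP[/eqP rw /words_code [b [c [cs e]]]].
have [Fe fF] := @code_edge_set k b c cs; set F := imset _ _ in Fe fF.
exists F; last by rewrite /f fF e.
by rewrite mem_enum inE; apply/asboolP/(spanning_tree_run Fe); rewrite fF e.
Qed.

(** The effect of one more path vertex, with a spoke or not, on the pair (t,
    s). *)
Definition step (p : nat * nat) (s : bool) :=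
  (if s then 2 * p.1 + p.2 else p.1, p.1 + p.2).

Fixpoint tree_counts k :=
  if k is k'.+1 then step (tree_counts k') (spoke k) else (1, 0).

(** The four possible letters for the last vertex, followed through the
    automaton, give the recurrence. *)
Lemma count_run k : (count (fun w => run w == Some true) (words k),
   count (fun w => run w == Some false) (words k)) = tree_counts k.
Proof.
elim: k => [//|k IH]; rewrite [tree_counts _]/= -IH /step /=.
pose N q := count (fun w => run w == Some q) (words k).
pose M x q := count (fun w => run w == Some q) [seq x :: w | w <- words k].
have cm x q q' : (forall o, (scan_step o x == Some q) = (o == Some q')) ->
    M x q = N q'.
  by move=> e; rewrite /M count_map; apply: eq_count => w /=; rewrite e.
have c0 x q : (forall o, (scan_step o x == Some q) = false) -> M x q = 0.
  move=> e; rewrite /M count_map -(count_pred0 (words k)).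
  by apply: eq_count => w /=; rewrite e.
have FFt : M (false, false) true = 0 by apply: c0 => -[[]|].
have FFf : M (false, false) false = N true by apply: cm => -[[]|].
have TFt : M (true, false) true = N true by apply: cm => -[[]|].
have TFf : M (true, false) false = N false by apply: cm => -[[]|].
have FTt : M (false, true) true = N true by apply: cm => -[[]|].
have FTf : M (false, true) false = 0 by apply: c0 => -[[]|].
have TTt : M (true, true) true = N false by apply: cm => -[[]|].
have TTf : M (true, true) false = 0 by apply: c0 => -[[]|].
rewrite !count_cat -!/(M _ _) FFt FFf TFt TFf; congr pair.
  case: (spoke _); rewrite ?count_cat -?/(M _ _) ?FTt ?TTt /=.
    by rewrite -/(N true) -/(N false); lia.
  by rewrite addn0.
case: (spoke _); rewrite ?count_cat -?/(M _ _) ?FTf ?TTf /=.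
  by rewrite -/(N true) -/(N false); lia.
by rewrite -/(N true) -/(N false); lia.
Qed.

Lemma tau_fan k : tau (fan k) = (tree_counts k).1.
Proof. by rewrite tau_run -count_run. Qed.

Lemma fan_connected k : graph_connected (fan k).
Proof.
apply: (@subfan_connected xpredT spoke) => i _; exists 0; split=> //.
by elim: i => //= i <-.
Qed.

End Fan.

Lemma eq_tree_counts l l' k : {in [pred j | j <= k], spoke l =1 spoke l'} ->
  tree_counts l k = tree_counts l' k.
Proof.
elim: k => //= k IH e; rewrite IH; last by move=> j jk; apply: e; apply: leqW.
by rewrite e // inE.
Qed.

Lemma tree_counts_foldl l : tree_counts l (size l).+1 = foldl step (1, 1) l.
Proof.
elim/last_ind: l => [//|l x IH].
rewrite foldl_rcons size_rcons -IH.
rewrite -[LHS]/(step (tree_counts _ (size l).+1) (spoke _ (size l).+2)).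
congr step.
  apply: eq_tree_counts => -[|[|j]] // jl; rewrite /spoke /= nth_rcons.
  by rewrite (_ : j < size l) //; move: jl; rewrite inE.
by rewrite /spoke /= nth_rcons ltnn eqxx.
Qed.

(** A path vertex without spoke beyond the last one hangs on the fan as part
    of a pendant path, which every spanning tree contains. *)
Lemma tree_counts_pad l k :
  (tree_counts l ((size l).+1 + k)).1 = (foldl step (1, 1) l).1.
Proof.
rewrite -tree_counts_foldl; elim: k => [|k IH]; first by rewrite addn0.
by rewrite addnS /= /spoke /= nth_default ?leq_addr.
Qed.

(** * Straight-line drawings of fans *)

Section Drawing.
Import numFieldNormedType.Exports.
Local Open Scope classical_set_scope.
Local Open Scope ring_scope.
Variables (R : realType) (l : bitseq) (k : nat).

Definition vertex_point (x : 'I_k.+1) : R * R :=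
  if x == ord0 then (0, 0) else (1, x%:R).

(** An edge of the fan is known once its larger vertex is known and whether it
    contains the hub, so these data define the arc. *)
Definition far_end (e : {set 'I_k.+1}) : nat := (\max_(i in e) i)%N.

Definition segment (e : {set 'I_k.+1}) (t : R) : R * R :=
  if ord0 \in e then (t, t * (far_end e)%:R) else (1, (far_end e)%:R - 1 + t).

Lemma far_end_pair (x y : 'I_k.+1) : (x <= y)%N -> far_end [set x; y]%SET = y.
Proof.
move=> xy; rewrite /far_end; apply/anti_leq/andP; split.
  by apply/bigmax_leqP => i; rewrite !inE => /pred2P[] ->.
apply: (@leq_bigmax_cond _ _ (fun i : 'I_k.+1 => i : nat)).
by rewrite !inE eqxx orbT.
Qed.

Lemma fan_edge (e : {set 'I_k.+1}) : e \in edges (fan l k) ->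
  exists x y : 'I_k.+1, [/\ e = [set x; y]%SET, (x < y)%N, far_end e = y,
    (ord0 \in e) = (x == ord0) & x != ord0 -> y = x.+1 :> nat].
Proof.
case/imsetP => -[x y] xy ->.
wlog lt : x y xy / (x < y)%N => [H|].
  case: (ltngtP x y) => [|yx|/val_inj exy]; first exact: H.
    rewrite finset.setUC; apply: (H y x) => //.
    by rewrite inE /= subfan_sym; rewrite inE in xy.
  by move: xy; rewrite inE /= exy [subfan _ _ _ _]fan_adj_irrefl.
exists x, y; split=> //.
- by rewrite far_end_pair // ltnW.
- rewrite !inE eq_sym [ord0 == y]eq_sym [y == _]negbTE ?orbF //.
  by apply: contraTneq lt => ->.
move=> x0; move: xy; rewrite inE => /or4P[] /andP[/eqP h _] //.
- by move: lt; rewrite h ltnNge leqnSn.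
- by case/eqP: x0; apply: val_inj.
- by move: lt; rewrite h.
Qed.

Lemma segment_continuous e : {within `[0, 1]%classic, continuous (segment e)}.
Proof.
have pairc (f g : R -> R) : continuous f -> continuous g ->
    continuous (fun t => (f t, g t)).
  move=> cf cg t.
  exact: (@cvg_pair R R R (nbhs t) (nbhs (f t)) (nbhs (g t)) _ _ _
           f g (cf t) (cg t)).
apply: continuous_subspaceT; rewrite /segment; case: (ord0 \in e).
  by apply: pairc => t; [exact: cvg_id|exact: mulrr_continuous].
apply: pairc => t; first exact: cvg_cst.
by apply: cvgD; [exact: cvg_cst|exact: cvg_id].
Qed.

(** Spokes are segments of different slopes between the lines x = 0 and x = 1,
    and the path edges are consecutive unit segments of the line x = 1. *)
Lemma fan_planar : planar R (fan l k).
Proof.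
exists vertex_point, segment; split.
- move=> x y; rewrite /vertex_point; case: eqP => [->|_];
    case: eqP => [->|_] //.
  + by move=> [/eqP]; rewrite eq_sym oner_eq0.
  + by move=> [/eqP]; rewrite oner_eq0.
  + by move=> [/eqP]; rewrite eqr_nat => /eqP /val_inj.
- move=> e _; split; first exact: segment_continuous.
  move=> s t _ _; rewrite /segment; case: ifP => _ [] //.
  by move/addrI.
- move=> x y xy e.
  have ee : e \in edges (fan l k) by apply/imsetP; exists (x, y); rewrite ?inE.
  have {ee} [x' [y' [e' lt a h st]]] := fan_edge ee.
  have y0 : (y' == ord0) = false by apply: contraTF lt => /eqP ->.
  have end0 : segment e 0 = vertex_point x'.
    rewrite /segment /vertex_point h a; case: ifP => [_|x0].
      by rewrite mul0r.
    by rewrite addr0 st ?x0 // -addn1 natrD addrK.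
  have end1 : segment e 1 = vertex_point y'.
    rewrite /segment /vertex_point h a y0; case: ifP => _.
      by rewrite mul1r.
    by rewrite subrK.
  rewrite end0 end1; case: (eq_set2 e') => -[-> ->]; first by left.
  by right.
- move=> e ee t; rewrite in_itv /= => /andP[t0 t1] z.
  have [x [y [_ _ a h st]]] := fan_edge ee.
  rewrite /segment /vertex_point h a; case: ifP => x0; case: ifP => z0 [].
  + by move=> t0'; rewrite t0' ltxx in t0.
  + by move=> t1'; rewrite t1' ltxx in t1.
  + by move/eqP; rewrite oner_eq0.
  + move=> e1; have yz : (y%:R - 1 < z%:R :> R) by rewrite -e1 ltrDl.
    have zy : (z%:R < y%:R :> R) by rewrite -e1; lra.
    move: yz zy; rewrite st ?x0 // -addn1 natrD addrK -natrD !ltr_nat; lia.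
move=> e f ee ef nef s t; rewrite !in_itv /= => /andP[s0 s1] /andP[t0 t1].
have [x [y [e1 lt a h st]]] := fan_edge ee.
have [x' [y' [f1 lt' a' h' st']]] := fan_edge ef.
rewrite /segment h h' a a'; case: ifP => x0; case: ifP => x0' [].
- move=> <- /(mulfI _) /eqP; rewrite gt_eqF // eqr_nat => /(_ isT)/eqP yy.
  by apply: nef; rewrite e1 f1 (eqP x0) (eqP x0') (val_inj yy).
- by move=> s1'; rewrite s1' ltxx in s1.
- by move=> t1'; rewrite -t1' ltxx in t1.
move=> est; case: (ltngtP y y') => [yy|yy|yy].
- have : (y%:R + 1 <= y'%:R :> R) by rewrite natr1 ler_nat.
  by lra.
- have : (y'%:R + 1 <= y%:R :> R) by rewrite natr1 ler_nat.
  by lra.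
apply: nef; rewrite e1 f1 (val_inj yy); congr [set _; _]%SET.
by apply: val_inj; apply: succn_inj; rewrite -st ?x0 // -st' ?x0'.
Qed.

End Drawing.

(** * Exponentially many values *)

(** The effect of [a - 1] path vertices without spoke followed by one with a
    spoke. *)
Definition block (p : nat * nat) (a : nat) : nat * nat :=
  ((a + 1) * p.1 + p.2, a * p.1 + p.2).

Fixpoint pairs m : seq (nat * nat) :=
  if m is m'.+1 then [seq block p a | p <- pairs m', a <- iota 1 6]
  else [:: (1, 1)].

Lemma foldl_block p a : foldl step p (rcons (nseq a false) true) = block p a.+1.
Proof.
elim: a p => [|a IH] p /=; first by rewrite /step /block /=; congr pair; lia.
by rewrite IH /step /block /=; congr pair; nia.
Qed.

Lemma pairs_foldl_step m p : p \in pairs m ->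
  exists l, size l <= 6 * m /\ foldl step (1, 1) l = p.
Proof.
elim: m p => [|m IH] p; first by rewrite inE => /eqP ->; exists [::].
case/allpairsP => -[q a] [/IH [l [sl /= e]] /= ia ->].
have /andP[a1 a6] : 1 <= a < 7 by rewrite -(mem_iota 1 6).
case: a ia a1 a6 => // a _ _ a6; exists (l ++ rcons (nseq a false) true); split.
  by rewrite size_cat size_rcons size_nseq; lia.
by rewrite foldl_cat e foldl_block.
Qed.

Lemma pairs_bounds m p : p \in pairs m -> 0 < p.2 <= p.1.
Proof.
elim: m p => [|m IH] p; first by rewrite inE => /eqP ->.
case/allpairsP => -[q a] [/IH /= q0 _ ->] /=; nia.
Qed.

(** The difference of the two components of [block p a] is [p.1]; as [p.2]
    lies in the interval from 1 to [p.1], the second component [a * p.1 + p.2]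
    then gives [a] and [p.2]. *)
Lemma block_inj p q a a' : 0 < p.2 <= p.1 -> 0 < q.2 <= q.1 ->
  block p a = block q a' -> p = q /\ a = a'.
Proof.
case: p q => [t s] [t' s'] /= h h' [e1 e2].
have et : t = t' by nia.
subst t'; have ea : a = a' by nia.
by subst a'; split=> //; congr pair; lia.
Qed.

Lemma block_bound p a : 0 < p.2 <= p.1 -> 0 < (block p a).1 <= (a + 2) * p.1.
Proof. by move=> h; rewrite /block /= addn2 addn1 !mulSn; lia. Qed.

Lemma uniq_pairs m : uniq (pairs m).
Proof.
elim: m => [//|m IH]; apply: allpairs_uniq => // x y.
move=> /allpairsP[[p a] [pm _ ->]].
move=> /allpairsP[[q a'] [qm _ ->]].
by move/(block_inj (pairs_bounds pm) (pairs_bounds qm)) => [-> ->].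
Qed.

Local Open Scope ring_scope.

(** Each block length [a] multiplies the first component by at most [a + 2],
    and 1/3 + 1/4 + ... + 1/8 = 1.217... *)
Lemma sum_inv_pairs (R : realFieldType) m :
  (6 / 5) ^+ m <= \sum_(p <- pairs m) (p.1%:R^-1 : R).
Proof.
elim: m => [|m IH]; first by rewrite big_seq1 expr0 invr1.
rewrite exprS; apply: le_trans (ler_wpM2l _ IH) _; first by lra.
have -> : \sum_(p <- pairs m.+1) p.1%:R^-1 =
    \sum_(p <- pairs m) \sum_(a <- iota 1 6) (block p a).1%:R^-1 :> R.
  exact: big_allpairs_dep.
rewrite mulr_sumr big_seq [leRHS]big_seq.
apply: ler_sum => p pm; have /andP[s0 st] := pairs_bounds pm.
have t0 : (0 < p.1%:R :> R) by rewrite ltr0n; lia.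
have term a : (a + 2)%N%:R^-1 * p.1%:R^-1 <= (block p a).1%:R^-1 :> R.
  have /andP[lo up] := block_bound a (pairs_bounds pm).
  by rewrite -invfM -natrM lef_pV2 ?posrE ?ltr0n ?ler_nat // (leq_trans lo).
apply: (@le_trans _ _ (\sum_(a <- iota 1 6) (a + 2)%N%:R^-1 * p.1%:R^-1)).
  rewrite -mulr_suml; apply: ler_wpM2r; first by rewrite invr_ge0 ltW.
  rewrite !big_cons big_nil.
  rewrite -[(1 + 2)%N]/3%N -[(2 + 2)%N]/4%N -[(3 + 2)%N]/5%N.
  by rewrite -[(4 + 2)%N]/6%N -[(5 + 2)%N]/7%N -[(6 + 2)%N]/8%N; lra.
by apply: ler_sum => a _; apply: term.
Qed.

(** At most [t] pairs have first component [t], so the pairs with first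
    component [t] contribute at most 1 to the sum. *)
Lemma sum_inv_le_undup (R : realFieldType) (s : seq (nat * nat)) : uniq s ->
  (forall p, p \in s -> (0 < p.2 <= p.1)%N) ->
  \sum_(p <- s) (p.1%:R^-1 : R) <= (size (undup (map fst s)))%:R.
Proof.
move=> us bs.
rewrite -(big_map fst xpredT (fun t : nat => t%:R^-1)) -big_undup_iterop_count.
rewrite -sum1_size natr_sum.
apply: ler_sum => t _; rewrite -[iterop _ _ _ _]/(_ *+ _).
have ct : (count_mem t (map fst s) <= t)%N.
  rewrite count_map -size_filter -(size_map snd) -[leqRHS](size_iota 1).
  apply: uniq_leq_size => [|u /mapP[p]].
    rewrite map_inj_in_uniq ?filter_uniq // => -[a b] [a' b'].
    by rewrite !mem_filter /= => /andP[/eqP-> _] /andP[/eqP-> _] ->.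
  rewrite mem_filter => /andP[/eqP /= <- /bs /andP[p0 p1]] ->.
  by rewrite mem_iota p0 add1n ltnS.
case: t ct => [|t] ct; first by rewrite invr0 mul0rn.
by rewrite -[leLHS]mulr_natl ler_pdivrMr ?ltr0n // mul1r ler_nat.
Qed.

Lemma tree_numbers_lower (R : realType) m n : (6 * m + 2 <= n)%N ->
  (6 / 5) ^+ m <= #|` fset_set (tree_numbers R n)|%:R :> R.
Proof.
move=> mn; apply: le_trans (sum_inv_pairs _ m) _.
apply: le_trans (sum_inv_le_undup _ (uniq_pairs m) (@pairs_bounds m)) _.
rewrite ler_nat; set s := map fst _.
have -> : size (undup s) = #|` [fset t in s]%fset|.
  by rewrite card_fseq.
apply: fsubset_leq_card; apply/fsubsetP => t; rewrite inE => /mapP[p pm ->].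
rewrite in_fset_set; last exact: finite_tree_numbers.
have [l [sl e]] := pairs_foldl_step pm; rewrite inE /=.
have k0 : ((size l).+1 + (n - (size l).+2)).+1 = n by lia.
exists (fan l ((size l).+1 + (n - (size l).+2))); split.
- exact: fan_connected.
- exact: fan_planar.
- by rewrite /= card_ord.
- by rewrite tau_fan tree_counts_pad e.
Qed.

Theorem theorem1p1 (R : realType) :
  exists c : R, 1 < c /\
    exists N : nat, forall n : nat, (N <= n)%N ->
      c ^+ n < #|` fset_set (tree_numbers R n)|%:R.
Proof.
(* The number m of blocks that fit satisfies n <= 7 m for large n, so any c
   with c ^ 7 < 6/5 works. *)
exists (51 / 50); split; first by lra.
exists 60%N => n n60; pose m := ((n - 2) %/ 6)%N.
have m0 : (0 < m)%N by rewrite /m; lia.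
have mn : (6 * m + 2 <= n)%N by rewrite /m; lia.
have nm : (n <= 7 * m)%N by rewrite /m; lia.
apply: lt_le_trans (tree_numbers_lower R mn).
apply: (@le_lt_trans _ _ ((51 / 50) ^+ (7 * m))).
  by apply: ler_weXn2l => //; lra.
rewrite exprM ltr_pXn2r // ?nnegrE.
- by rewrite !exprS expr0; lra.
- by apply: exprn_ge0; lra.
- by lra.
Qed.
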